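(* Let $\mathcal{H},\mathcal{K}$ be Hilbert spaces, let $V\in\mathcal{B}(\mathcal{H})$ be an isometry, let $T\in\mathcal{B}(\mathcal{K})$ be a right invertible contraction, and for $Y\in\mathcal{B}(\mathcal{H},\mathcal{K})$ write $$R(Y)=\begin{bmatrix}T & Y\\ 0 & V\end{bmatrix}\in\mathcal{B}(\mathcal{K}\oplus\mathcal{H}),$$ so $R(0)=T\oplus V$. Let $X\in\mathcal{B}(\mathcal{H},\mathcal{K})$. Then $R(X)$ is similar to a contraction if and only if $R(X)$ is power bounded and there exist $A\in\mathcal{B}(\mathcal{H},\mathcal{K})$ and a nilpotent $E\in\mathcal{B}(\mathcal{K}\oplus\mathcal{H})$ with $ER(A)=0$ and $R(X)=R(A)+E$, such that $R(A)$ is quadratically near $R(0)$ modulo $\ker V^*$, i.e. there is a constant $s$ with $$\Big\|\sum_{n=0}^{N}\big(R(A)^n-R(0)^n\big)x_n\Big\|\le s\Big(\sum_{n=0}^N\|x_n\|^2\Big)^{1/2}$$ for every $N\in\mathbb{N}$ and all $x_0,\ldots,x_N\in\{0\}\oplus\ker V^*\subset\mathcal{K}\oplus\mathcal{H}$.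
   Context: An operator is power bounded if the norms of its powers are uniformly bounded; it is similar to a contraction if it is conjugate by an invertible operator to an operator of norm at most 1. *)

(* Defs.v *)
From mathcomp Require Import all_boot all_algebra complex.
From mathcomp Require Import reals.
Set Implicit Arguments. Unset Strict Implicit. Unset Printing Implicit Defensive.
Import GRing.Theory Num.Theory.
Local Open Scope ring_scope.

Section Hilbert.
Variable R : realType.
Local Notation C := (R[i]).

Definition hnorm (X : lmodType C) (ip : X -> X -> C) (x : X) : R :=
  Num.sqrt (complex.Re (ip x x)).

Record is_hilbert (X : lmodType C) (ip : X -> X -> C) : Prop := {
  ip_linear : forall (a : C) (x y z : X), ip (a *: x + y) z = a * ip x z + ip y z;
  ip_conj : forall x y : X, ip y x = (ip x y)^*;
  ip_ge0 : forall x : X, 0 <= ip x x;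
  ip_eq0 : forall x : X, ip x x = 0 -> x = 0;
  ip_complete : forall u : nat -> X,
    (forall e : R, 0 < e -> exists N, forall m n, (N <= m)%N -> (N <= n)%N ->
        hnorm ip (u m - u n) < e) ->
    exists l : X, forall e : R, 0 < e -> exists N, forall n, (N <= n)%N ->
        hnorm ip (u n - l) < e }.

Definition bounded_op (X Y : lmodType C) (ipX : X -> X -> C) (ipY : Y -> Y -> C)
    (f : X -> Y) : Prop :=
  (forall (a : C) (x y : X), f (a *: x + y) = a *: f x + f y) /\
  exists M : R, forall x, hnorm ipY (f x) <= M * hnorm ipX x.

Definition contraction (X : lmodType C) (ip : X -> X -> C) (f : X -> X) : Prop :=
  forall x, hnorm ip (f x) <= hnorm ip x.

Definition isometry_op (X Y : lmodType C) (ipX : X -> X -> C) (ipY : Y -> Y -> C)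
    (f : X -> Y) : Prop :=
  forall x, hnorm ipY (f x) = hnorm ipX x.

Definition right_invertible (X : lmodType C) (ip : X -> X -> C) (f : X -> X) : Prop :=
  exists g, bounded_op ip ip g /\ forall x, f (g x) = x.

Definition power_bounded (X : lmodType C) (ip : X -> X -> C) (f : X -> X) : Prop :=
  exists M : R, forall (n : nat) (x : X), hnorm ip (iter n f x) <= M * hnorm ip x.

Definition similar_to_contraction (X : lmodType C) (ip : X -> X -> C) (f : X -> X)
  : Prop :=
  exists S Si : X -> X, [/\ bounded_op ip ip S, bounded_op ip ip Si,
    (forall x, S (Si x) = x), (forall x, Si (S x) = x) &
    contraction ip (fun x => Si (f (S x)))].

Definition nilpotent (X : lmodType C) (f : X -> X) : Prop :=
  exists n : nat, forall x, iter n f x = 0.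

(* x in ker V^*, where V : H -> H; since <x, V^* h> = <V x, h>, this is
   V^* h = 0 written through the defining property of the adjoint *)
Definition in_ker_adj (H : lmodType C) (ipH : H -> H -> C) (V : H -> H) (h : H)
  : Prop := forall x, ipH (V x) h = 0.

Definition ip_sum (K H : lmodType C) (ipK : K -> K -> C) (ipH : H -> H -> C)
    (p q : (K * H)%type) : C := ipK p.1 q.1 + ipH p.2 q.2.

Definition Rop (K H : lmodType C) (T : K -> K) (V : H -> H) (Y : H -> K)
    (p : (K * H)%type) : (K * H)%type := (T p.1 + Y p.2, V p.2).

Definition quad_near_mod_ker (K H : lmodType C) (ipK : K -> K -> C)
    (ipH : H -> H -> C) (T : K -> K) (V : H -> H) (A : H -> K) : Prop :=
  exists s : R, forall (N : nat) (x : nat -> (K * H)%type),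
    (forall n, (n <= N)%N -> (x n).1 = 0 /\ in_ker_adj ipH V (x n).2) ->
    hnorm (ip_sum ipK ipH)
      (\sum_(n < N.+1) (iter n (Rop T V A) (x n) - iter n (Rop T V (fun _ => 0)) (x n)))
    <= s * Num.sqrt (\sum_(n < N.+1) hnorm (ip_sum ipK ipH) (x n) ^+ 2).

End Hilbert.

(* Main.v *)
(* Both conditions say that the cocycle X splits: X = T W - W V for some bounded W, in which
   case R(X) is conjugate to R(0) by a shear.

   If R(X) is similar to a contraction, transport the Hilbert norm of the contraction to
   K + H and split off the orthogonal complement of K: one gets equivalent quadratic forms
   p on K, q on H and a map Y cohomologous to X with p(T k + Y h) + q(V h) <= p(k) + q(h).
   Maps f_n with f_0 = 1 and f_(n+1) V = f_n, built from projections onto ran V for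
   auxiliary forms so that the q(f_n h) - q(V f_n h) are summable, make the partial sums
   Z_N = sum_(i<N) T^i Y f_(i+1) uniformly bounded, while Z_(N+1) V = T Z_N + Y; a Banach
   limit of the Z_N splits Y.  Given W, the map A = T U - U V with U = W V V^* agrees with X
   on ran V and is quadratically near since U kills ker V^*.

   Conversely E = R(X) - R(A) forces X = A on ran V.  With A_n the corner of R(A)^n and
   P = 1 - V V^*, the operators Z_N = - A_N V^*^N - sum_(n<N) A_n P V^*^n satisfy
   Z_(N+1) V = T Z_N - A exactly, and are uniformly bounded: the first term by power
   boundedness, the second by quadratic nearness.  A Banach limit splits A, and g (X - A)
   splits X - A when T g = 1. *)
From mathcomp Require Import all_boot all_order all_algebra complex.
From mathcomp Require Import boolp classical_sets functions filter reals.
From mathcomp Require Import topology normedtype sequences.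
From mathcomp Require Import ring lra.
Require Import Defs.
Set Implicit Arguments. Unset Strict Implicit. Unset Printing Implicit Defensive.
Import Order.TTheory GRing.Theory Num.Theory.
Import numFieldNormedType.Exports.
Local Open Scope ring_scope.

(** * Banach limits *)

Section BanachLimit.
Local Open Scope classical_set_scope.

Definition bounded_seq (R : realType) (a : nat -> R) := exists M, forall n, `|a n| <= M.

Record banach_limit (R : realType) (L : (nat -> R) -> R) : Prop := {
  blimD : forall a b, bounded_seq a -> bounded_seq b -> L (fun n => a n + b n) = L a + L b;
  blimZ : forall r a, bounded_seq a -> L (fun n => r * a n) = r * L a;
  blimC : forall r, L (fun=> r) = r;
  blimS : forall a, bounded_seq a -> L (fun n => a n.+1) = L a;
  blim_le : forall a M, (forall n, `|a n| <= M) -> `|L a| <= M }.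

(** The image ultrafilter contains the compact segment [[- M, M]], so it has a cluster point, and an
    ultrafilter converges to each of its cluster points. *)
Lemma ultra_bounded_cvg (R : realType) (U : set_system nat) (a : nat -> R) :
  UltraFilter U -> bounded_seq a -> cvg (a @ U).
Proof.
move=> UU [M aM].
have UPF : ProperFilter U by exact: ultra_proper.
have [|l [_ al]] := @segment_compact R (- M) M (a @ U) (fmap_proper_filter a UPF).
  change (U (a @^-1` `[- M, M])); apply: (@filterS _ U _ setT) => [n _|]; last exact: filterT.
  by rewrite /= in_itv /= -ler_norml.
apply/cvg_ex; exists l => B lB.
have [//|UB] := in_ultra_setVsetC (a @^-1` B) UU.
by have [x []] := al (~` B) B UB lB.
Qed.

Lemma bounded_mean (R : realType) (a : nat -> R) M :
  (forall n, `|a n| <= M) -> forall n, `|arithmetic_mean a n| <= M.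
Proof.
move=> aM n; rewrite /arithmetic_mean /= normrM gtr0_norm ?invr_gt0 //.
rewrite ler_pdivrMl // seriesEnat /=.
apply: le_trans (ler_norm_sum _ _ _) _.
apply: le_trans (ler_sum _ (fun i _ => aM i)) _.
by rewrite big_const_nat subn0 iter_addr_0 mulr_natl.
Qed.

(** Cesàro means followed by a limit along a free ultrafilter. Averaging gives shift invariance:
    shifting changes the n-th mean by [(a_(n+1) - a_0) / (n+1)], which tends to 0. *)
Lemma exists_banach_limit (R : realType) : exists L : (nat -> R) -> R, banach_limit L.
Proof.
have [U [UU leU]] := @ultraFilterLemma nat \oo _.
have UPF : ProperFilter U by exact: ultra_proper.
have bm a : bounded_seq a -> cvg (@arithmetic_mean R a @ U).
  by move=> [M /bounded_mean aM]; apply: ultra_bounded_cvg; exists M.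
exists (fun a => lim (@arithmetic_mean R a @ U)); split.
- move=> a b /bm ca /bm cb; rewrite -limD //; congr (lim (_ @ U)).
  apply/funext => n; rewrite /arithmetic_mean /= !seriesEnat /=.
  by rewrite big_split mulrDr.
- move=> r a /bm ca.
  rewrite (_ : arithmetic_mean _ = fun n => r * @arithmetic_mean R a n).
    by apply: cvg_lim => //; exact: cvgMl_tmp.
  apply/funext => n; rewrite /arithmetic_mean /= !seriesEnat /=.
  by rewrite -mulr_sumr mulrCA.
- move=> r; rewrite (_ : arithmetic_mean _ = fun=> r) ?lim_cst //.
  apply/funext => n; rewrite /arithmetic_mean /= seriesEnat /=.
  by rewrite big_const_nat subn0 iter_addr_0 -[r *+ _]mulr_natl mulKf // pnatr_eq0.
- move=> a [M aM]; have ca := bm a (ex_intro _ M aM).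
  pose d n := harmonic n * (a n.+1 - a 0%N).
  rewrite (_ : arithmetic_mean _ = fun n => @arithmetic_mean R a n + d n); last first.
    apply/funext => n; rewrite /arithmetic_mean /d /= -mulrDr; congr (_ * _).
    by rewrite !seriesEnat /= -telescope_sumr // -big_split /=; apply: eq_bigr => i _; ring.
  have d0 : d @ U --> (0 : R).
    apply: cvg_trans (_ : d @ \oo --> (0 : R)); first exact: cvg_app.
    apply: norm_cvg0.
    apply: (@squeeze_cvgr _ _ _ _ (fun=> 0) (fun n => harmonic n * (M + M))).
    - apply: nearW => n; rewrite normr_ge0 /= /d normrM ger0_norm ?harmonic_ge0 //.
      by rewrite ler_wpM2l ?harmonic_ge0 // (le_trans (ler_normB _ _)) // lerD.
    - exact: cvg_cst.
    - by rewrite -(mul0r (M + M)); apply: cvgMr_tmp; exact: cvg_harmonic.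
  by rewrite limD //; [rewrite (cvg_lim _ d0) ?addr0 | apply/cvg_ex; exists 0].
- move=> a M aM; have ca := bm a (ex_intro _ M aM).
  rewrite -lim_norm //; apply: limr_le; first exact: is_cvg_norm.
  by apply: nearW; exact: bounded_mean.
Qed.

End BanachLimit.

(** * Real parts of inner products *)

Section LinearMaps.
Variables (R : realType) (X Y : lmodType R[i]).

Definition lin (f : X -> Y) := forall (a : R[i]) x y, f (a *: x + y) = a *: f x + f y.

Variable f : X -> Y.
Hypothesis lf : lin f.

Lemma linD x y : f (x + y) = f x + f y.
Proof. by have := lf 1 x y; rewrite !scale1r. Qed.

Lemma lin0 : f 0 = 0.
Proof. by apply: (addrI (f 0)); rewrite -linD !addr0. Qed.

Lemma linZ a x : f (a *: x) = a *: f x.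
Proof. by have := lf a x 0; rewrite lin0 !addr0. Qed.

Lemma linN x : f (- x) = - f x.
Proof. by rewrite -scaleN1r linZ scaleN1r. Qed.

Lemma linB x y : f (x - y) = f x - f y.
Proof. by rewrite linD linN. Qed.

Lemma lin_sum n (x : nat -> X) : f (\sum_(i < n) x i) = \sum_(i < n) f (x i).
Proof. by elim: n => [|n IH]; rewrite ?big_ord0 ?lin0 // !big_ord_recr /= linD IH. Qed.

End LinearMaps.

Section LinearOps.
Variables (R : realType) (X Y Z : lmodType R[i]).

Lemma lin_comp (f : Y -> Z) (g : X -> Y) : lin f -> lin g -> lin (fun x => f (g x)).
Proof. by move=> lf lg a x y; rewrite lg lf. Qed.

Lemma lin_id : lin (@id X).
Proof. by []. Qed.

Lemma lin_add (f g : X -> Y) : lin f -> lin g -> lin (fun x => f x + g x).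
Proof. by move=> lf lg a x y; rewrite lf lg scalerDr addrACA. Qed.

Lemma lin_opp (f : X -> Y) : lin f -> lin (fun x => - f x).
Proof. by move=> lf a x y; rewrite lf opprD scalerN. Qed.

Lemma lin_iter n (f : X -> X) : lin f -> lin (iter n f).
Proof. by move=> lf; elim: n => [|n IH] a x y //=; rewrite IH lf. Qed.

Lemma lin_bigsum n (f : nat -> X -> Y) :
  (forall i, lin (f i)) -> lin (fun x => \sum_(i < n) f i x).
Proof.
by move=> lf a x y; rewrite scaler_sumr -big_split; apply: eq_bigr => i _; rewrite lf.
Qed.

Lemma lin_inl : lin (fun x : X => (x, 0 : Y)).
Proof. by move=> a x x'; congr pair; rewrite /= scaler0 addr0. Qed.

Lemma lin_inr : lin (fun y : Y => (0 : X, y)).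
Proof. by move=> a y y'; congr pair; rewrite /= scaler0 addr0. Qed.

End LinearOps.

(* The real part of a semi-inner product; [formJ] carries the complex sesquilinearity. *)
Record psd_form (R : realType) (X : lmodType R[i]) (B : X -> X -> R) : Prop := {
  formDl : forall x y z, B (x + y) z = B x z + B y z;
  formZl : forall (r : R) x y, B (r%:C%C *: x) y = r * B x y;
  formJ : forall (a : R[i]) x y, B (a *: x) y = B x (a^* *: y);
  formC : forall x y, B x y = B y x;
  form_ge0 : forall x, 0 <= B x x }.

Record hilbert_form (R : realType) (X : lmodType R[i]) (B : X -> X -> R) : Prop := {
  hf_form : psd_form B;
  hf_eq0 : forall x, B x x = 0 -> x = 0;
  hf_complete : forall u : nat -> X,
    (forall e : R, 0 < e -> exists N, forall m n, (N <= m)%N -> (N <= n)%N ->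
       B (u m - u n) (u m - u n) < e) ->
    exists l : X, forall e : R, 0 < e -> exists N, forall n, (N <= n)%N ->
       B (u n - l) (u n - l) < e }.

Section FormTheory.
Variables (R : realType) (X : lmodType R[i]) (B : X -> X -> R).
Hypothesis fB : psd_form B.

Lemma formDr x y z : B x (y + z) = B x y + B x z.
Proof. by rewrite !(formC fB x) formDl. Qed.

Lemma formZr (r : R) x y : B x (r%:C%C *: y) = r * B x y.
Proof. by rewrite !(formC fB x) formZl. Qed.

Lemma formJr (a : R[i]) x y : B x (a *: y) = B (a^* *: x) y.
Proof. by rewrite formC // formJ // formC. Qed.

Lemma formNl x y : B (- x) y = - B x y.
Proof. by have := formZl fB (-1) x y; rewrite rmorphN1 scaleN1r mulN1r. Qed.

Lemma formNr x y : B x (- y) = - B x y.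
Proof. by rewrite !(formC fB x) formNl. Qed.

Lemma form0l y : B 0 y = 0.
Proof. by have := formZl fB 0 0 y; rewrite scaler0 mul0r. Qed.

Lemma form0r x : B x 0 = 0.
Proof. by rewrite formC // form0l. Qed.

Lemma formDsqr x y : B (x + y) (x + y) = B x x + 2 * B x y + B y y.
Proof. by rewrite formDl // !formDr (formC fB y x); ring. Qed.

Lemma formBsqr x y : B (x - y) (x - y) = B x x - 2 * B x y + B y y.
Proof. by rewrite formDsqr formNr formNl formNr; ring. Qed.

Lemma formNsqr x : B (- x) (- x) = B x x.
Proof. by rewrite formNl formNr opprK. Qed.

Lemma formD_le x y : B (x + y) (x + y) <= 2 * (B x x + B y y).
Proof. by have := form_ge0 fB (x - y); rewrite formBsqr formDsqr; lra. Qed.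

Lemma form_CS x y : B x y ^+ 2 <= B x x * B y y.
Proof.
have P r : 0 <= B x x - 2 * r * B x y + r ^+ 2 * B y y.
  have := form_ge0 fB (x - r%:C%C *: y).
  by rewrite formBsqr formZl // !formZr; congr (_ <= _); ring.
have [y0|y0] := eqVneq (B y y) 0.
  suff -> : B x y = 0 by rewrite y0 mulr0 expr2 mul0r.
  apply/eqP/negP => /negP b0.
  (* When [B y y = 0] the bound [P] is affine in [r]; this [r] would give it the value -1. *)
  have := P ((B x x + 1) / (2 * B x y)); rewrite y0 mulr0 addr0.
  rewrite (_ : 2 * _ * _ = B x x + 1); last by field.
  lra.
have yp : 0 < B y y by rewrite lt_neqAle eq_sym y0 form_ge0.
have := P (B x y / B y y).
rewrite (_ : _ + _ = (B x x * B y y - B x y ^+ 2) / B y y); last by field.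
by rewrite pmulr_lge0 ?invr_gt0 // subr_ge0.
Qed.

End FormTheory.

(** * Equivalent Hilbert forms and Riesz representation *)

Section HilbertForms.
Variables (R : realType) (X : lmodType R[i]).

Lemma hilbert_form_equiv (B B' : X -> X -> R) (d M : R) :
  hilbert_form B -> psd_form B' -> 0 < d ->
  (forall x, d * B x x <= B' x x) -> (forall x, B' x x <= M * B x x) ->
  hilbert_form B'.
Proof.
move=> hB fB' d0 dB BM; have fB := hf_form hB; split=> // [x x0|u cu].
  apply: (hf_eq0 hB); apply/eqP; rewrite eq_le form_ge0 // andbT.
  by rewrite -(pmulr_rle0 _ d0) -x0.
have [|l ul] := hf_complete hB (u := u).
  move=> e e0; have [N uN] := cu _ (mulr_gt0 d0 e0).
  exists N => m n Nm Nn; rewrite -(ltr_pM2l d0).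
  exact: le_lt_trans (dB _) (uN _ _ Nm Nn).
exists l => e e0; have M1 : 0 < `|M| + 1 by rewrite ltr_wpDl.
have [N uN] := ul _ (divr_gt0 e0 M1); exists N => n Nn.
apply: le_lt_trans (BM _) _; have := uN n Nn; rewrite ltr_pdivlMr // => /le_lt_trans -> //.
rewrite mulrC ler_wpM2l ?form_ge0 //; have := ler_norm M; lra.
Qed.

(* The representing vector minimises [B x x - 2 * f x]. *)
Lemma riesz (B : X -> X -> R) (f : X -> R) (M : R) :
  hilbert_form B -> (forall x y, f (x + y) = f x + f y) ->
  (forall (r : R) x, f (r%:C%C *: x) = r * f x) -> 0 <= M ->
  (forall x, f x ^+ 2 <= M * B x x) -> exists z, forall x, B x z = f x.
Proof.
move=> hB fD fZ M0 fM; have fB := hf_form hB.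
pose J x := B x x - 2 * f x.
(* Otherwise [2 t > s + M], against [(2 t)^2 <= 4 M s <= (s + M)^2]. *)
have JM x : - M <= J x.
  rewrite /J; have := fM x; have := form_ge0 fB x; set s := B x x; set t := f x.
  move=> s0 ts; rewrite leNgt; apply/negP => h.
  have : (s + M) ^+ 2 < (2 * t) ^+ 2.
    rewrite -subr_gt0 (_ : _ - _ = (2 * t - s - M) * (2 * t + s + M)); last by ring.
    by rewrite mulr_gt0 //; lra.
  have := sqr_ge0 (s - M); nra.
pose E : set R := (fun y => exists x, y = J x).
have infE : has_inf E.
  by split; [exists (J 0), 0 | exists (- M) => _ [x ->]].
pose d := inf E.
have dJ x : d <= J x by apply: ge_inf; [exact: infE.2 | exists x].
have [u uJ] : exists u : nat -> X, forall n, J (u n) < d + n.+1%:R^-1.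
  suff /choice[u uP] : forall n, exists x, J x < d + n.+1%:R^-1 by exists u.
  move=> n.
  have e0 : 0 < n.+1%:R^-1 :> R by rewrite invr_gt0.
  by have [_ [x ->] Jx] := inf_adherent e0 infE; exists x.
(* The parallelogram law, with [J] at the midpoint at least [d], makes minimising sequences
   Cauchy. *)
have quad x y : B (x - y) (x - y) <= 2 * (J x + J y - 2 * d).
  have := dJ ((2^-1)%:C%C *: (x + y)).
  rewrite /J fZ fD formZl // formZr // formDsqr // formBsqr //; lra.
have inv_small (e : R) : 0 < e -> exists N, forall n, (N <= n)%N -> n.+1%:R^-1 < e.
  move=> e0; have [N Ne] := ltr_add_invr (y := 0) (x := e) e0.
  rewrite add0r in Ne; exists N => n Nn; apply: le_lt_trans Ne.
  by rewrite lef_pV2 ?posrE // ler_nat.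
have [|z uz] := hf_complete hB (u := u).
  move=> e e0; have e4 : 0 < e / 4 by lra.
  have [N Ne] := inv_small _ e4.
  exists N => m n Nm Nn; apply: le_lt_trans (quad _ _) _.
  have := Ne m Nm; have := Ne n Nn; have := uJ m; have := uJ n.
  move: (n.+1%:R^-1) (m.+1%:R^-1) (J _) (J _) => ????; lra.
exists z => x.
(* Approximate first-order condition: [J (u n + t x) >= d] for all [t] gives a nonnegative quadratic
   in [t], and its discriminant bounds the error. *)
have key n : (B x (u n) - f x) ^+ 2 <= n.+1%:R^-1 * B x x.
  set b := B x (u n) - f x; set e := n.+1%:R^-1.
  have P t : 0 <= e + 2 * t * b + t ^+ 2 * B x x.
    have := dJ (u n + t%:C%C *: x); have := uJ n; rewrite -/e /J.
    rewrite formDsqr // formZl // !formZr // fD fZ (formC fB (u n) x) /b; lra.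
  have [x0|x0] := eqVneq (B x x) 0.
    have [b0|b0] := eqVneq b 0; first by rewrite b0 x0 mulr0 expr2 mul0r.
    have := P (- (e + 1) / (2 * b)); rewrite x0 mulr0 addr0.
    rewrite (_ : 2 * _ * _ = - (e + 1)); last by field.
    lra.
  have xp : 0 < B x x by rewrite lt_neqAle eq_sym x0 form_ge0.
  have := P (- b / B x x).
  rewrite (_ : _ + _ = (e * B x x - b ^+ 2) / B x x); last by field.
  by rewrite pmulr_lge0 ?invr_gt0 // subr_ge0.
apply/eqP; rewrite -subr_eq0 -sqrf_eq0 eq_le sqr_ge0 andbT.
apply/ler_addgt0Pl => e e0; rewrite addr0.
(* The factor 4 shares [e] between the error in [key] and the distance from [u n] to [z]; the [+ 1]
   covers [B x x = 0]. *)
have c0 : 0 < 4 * (B x x + 1) by have := form_ge0 fB x; lra.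
have [N1 h1] := inv_small _ (divr_gt0 e0 c0).
have [N2 h2] := uz _ (divr_gt0 e0 c0).
pose n := maxn N1 N2.
have := h1 n (leq_maxl _ _); have := h2 n (leq_maxr _ _); have := key n.
rewrite !ltr_pdivlMr //; move: (n.+1%:R^-1) => e1.
have := form_CS fB x (u n - z); rewrite formDr // formNr //.
have := form_ge0 fB x; have := form_ge0 fB (u n - z).
move: (B (u n - z) _) (B x (u n)) (B x z) (f x) (B x x) => w a b c q w0 q0 H1 H2 H3 H4.
have : (b - c) ^+ 2 <= 2 * ((a - b) ^+ 2 + (a - c) ^+ 2).
  by have := sqr_ge0 (2 * a - b - c); lra.
nra.
Qed.

End HilbertForms.

(** * Bounded operators, adjoints and weak limits *)

Definition qbounded (R : realType) (X Y : lmodType R[i]) (BX : X -> X -> R)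
    (BY : Y -> Y -> R) (f : X -> Y) :=
  lin f /\ exists2 M : R, 0 <= M & forall x, BY (f x) (f x) <= M * BX x x.

Section Operators.
Variable R : realType.
Implicit Types X Y Z : lmodType R[i].

Lemma qbounded_comp X Y Z (BX : X -> X -> R) (BY : Y -> Y -> R) (BZ : Z -> Z -> R) f g :
  qbounded BY BZ f -> qbounded BX BY g -> qbounded BX BZ (fun x => f (g x)).
Proof.
move=> [lf [M M0 fM]] [lg [N N0 gN]]; split; first exact: lin_comp.
exists (M * N) => [|x]; first exact: mulr_ge0.
by apply: le_trans (fM _) _; rewrite -mulrA ler_wpM2l.
Qed.

Lemma qbounded_add X Y (BX : X -> X -> R) (BY : Y -> Y -> R) f g : psd_form BY ->
  qbounded BX BY f -> qbounded BX BY g -> qbounded BX BY (fun x => f x + g x).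
Proof.
move=> fY [lf [M M0 fM]] [lg [N N0 gN]]; split; first exact: lin_add.
exists (2 * (M + N)) => [|x]; first by rewrite mulr_ge0 // addr_ge0.
by have := formD_le fY (f x) (g x); have := fM x; have := gN x; lra.
Qed.

Lemma qbounded_opp X Y (BX : X -> X -> R) (BY : Y -> Y -> R) f : psd_form BY ->
  qbounded BX BY f -> qbounded BX BY (fun x => - f x).
Proof.
move=> fY [lf [M M0 fM]]; split; first exact: lin_opp.
by exists M => // x; rewrite formNsqr.
Qed.

Lemma hilbert_form_inj X (B : X -> X -> R) x x' : hilbert_form B ->
  (forall y, B y x = B y x') -> x = x'.
Proof.
move=> hB e; apply/eqP; rewrite -subr_eq0; apply/eqP/(hf_eq0 hB).
have fB := hf_form hB.
by rewrite formDr // formNr // e subrr.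
Qed.

(** Riesz is applied for each [x]. Uniqueness of the representing vector makes [f] linear, the [a^*]
    hypothesis supplying complex scalars although only real parts occur; testing at [y = f x] and
    cancelling one factor gives the bound. *)
Lemma riesz_op X Y (BX : X -> X -> R) (BY : Y -> Y -> R) (G : X -> Y -> R) (M : R) :
  psd_form BX -> hilbert_form BY ->
  (forall x x' y, G (x + x') y = G x y + G x' y) ->
  (forall (a : R[i]) x y, G (a *: x) y = G x (a^* *: y)) ->
  (forall x y y', G x (y + y') = G x y + G x y') ->
  (forall (r : R) x y, G x (r%:C%C *: y) = r * G x y) ->
  0 <= M -> (forall x y, G x y ^+ 2 <= M * BX x x * BY y y) ->
  exists f : X -> Y, [/\ lin f, forall x y, BY y (f x) = G x y &
    forall x, BY (f x) (f x) <= M * BX x x].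
Proof.
move=> fX hY GDl GJ GDr GZr M0 GM; have fY := hf_form hY.
have /choice[f fG] x : exists z, forall y, BY y z = G x y.
  apply: (riesz hY (GDr x) (fun r => GZr r x) _ (GM x)).
  by rewrite mulr_ge0 // (form_ge0 fX).
exists f; split=> // [a x x'|x].
  apply: (hilbert_form_inj hY) => y.
  by rewrite formDr // formJr // !fG GDl GJ.
have := GM x (f x); rewrite -fG; have := form_ge0 fY (f x).
rewrite le_eqVlt => /predU1P[<- _|t0]; first by rewrite mulr_ge0 // (form_ge0 fX).
by rewrite expr2 ler_pM2r.
Qed.

Lemma exists_adjoint X Y (BX : X -> X -> R) (BY : Y -> Y -> R) (f : X -> Y) (M : R) :
  hilbert_form BX -> psd_form BY -> lin f -> 0 <= M ->
  (forall x, BY (f x) (f x) <= M * BX x x) ->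
  exists g : Y -> X, [/\ lin g, forall x y, BX x (g y) = BY (f x) y &
    forall y, BX (g y) (g y) <= M * BY y y].
Proof.
move=> hX fY lf M0 fM.
have := @riesz_op _ _ BY BX (fun y x => BY (f x) y) M fY hX.
case=> //.
- by move=> y y' x; rewrite formDr.
- by move=> a y x; rewrite formJr // linZ.
- by move=> y x x'; rewrite linD // formDl.
- by move=> r y x; rewrite linZ // formZl.
- move=> y x; apply: le_trans (form_CS fY _ _) _.
  by rewrite mulrAC ler_wpM2r // (form_ge0 fY).
by move=> g [lg gf gM]; exists g; split.
Qed.

(* A Banach limit of the Z_n in the weak operator topology. *)
Lemma intertwiner_of_bounded_seq X Y (BX : X -> X -> R) (BY : Y -> Y -> R)
    (T : Y -> Y) (V : X -> X) (A : X -> Y) (Z : nat -> X -> Y) (M : R) :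
  psd_form BX -> hilbert_form BY -> qbounded BY BY T ->
  (forall n, lin (Z n)) -> 0 <= M -> (forall n x, BY (Z n x) (Z n x) <= M * BX x x) ->
  (forall n x, Z n.+1 (V x) = T (Z n x) + A x) ->
  exists W : X -> Y, qbounded BX BY W /\ forall x, W (V x) = T (W x) + A x.
Proof.
move=> fX hY [lT [MT MT0 TM]] lZ M0 ZM ZV; have fY := hf_form hY.
have [L HL] := exists_banach_limit R.
have [Ts [lTs TTs _]] := exists_adjoint hY fY lT MT0 TM.
pose c x y := Num.sqrt (M * BX x x * BY y y).
have c0 x y : 0 <= M * BX x x * BY y y.
  by rewrite !mulr_ge0 // ?(form_ge0 fX) ?(form_ge0 fY).
have Zc x y n : `|BY y (Z n x)| <= c x y.
  rewrite -sqrtr_sqr ler_wsqrtr //; apply: le_trans (form_CS fY _ _) _.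
  by rewrite mulrC ler_wpM2r // (form_ge0 fY).
have bZ x y : bounded_seq (fun n => BY y (Z n x)) by exists (c x y).
have [|||||W [lW WG WM]] :=
    @riesz_op _ _ BX BY (fun x y => L (fun n => BY y (Z n x))) M fX hY _ _ _ _ M0.
- move=> x x' y; rewrite -(blimD HL) //; congr L; apply/funext => n.
  by rewrite linD // formDr.
- by move=> a x y; congr L; apply/funext => n; rewrite linZ // formJr.
- move=> x y y'; rewrite -(blimD HL) //; congr L; apply/funext => n.
  by rewrite formDl.
- move=> r x y; rewrite -(blimZ HL) //; congr L; apply/funext => n.
  by rewrite formZl.
- move=> x y; rewrite -[leRHS]sqr_sqrtr // -[leLHS]real_normK ?num_real //.
  by rewrite lerXn2r ?nnegrE ?sqrtr_ge0 //; apply: (blim_le HL) => n; apply: Zc.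
exists W; split; first by split=> //; exists M.
move=> x; apply: (hilbert_form_inj hY) => y.
(* [T] moves to the test vector through its adjoint [Ts], so that both sides become values of [L];
   shift invariance then replaces [Z n] by [Z n.+1], where the recurrence applies. *)
rewrite WG formDr // -[BY y (T _)](formC fY) -TTs (formC fY) WG.
rewrite -(blimS HL) // -[in RHS](blimC HL (BY y (A x))) -(blimD HL) //; last first.
  by exists `|BY y (A x)|.
congr L; apply/funext => n; rewrite ZV formDr //.
by rewrite (formC fY (Ts y)) TTs (formC fY y).
Qed.

End Operators.

(** * Commutant lifting for isometries *)

Section FormConstructions.
Variables (R : realType) (X Y : lmodType R[i]).
Implicit Types B : X -> X -> R.

Lemma psd_form_comp (BY : Y -> Y -> R) (f : X -> Y) :
  psd_form BY -> lin f -> psd_form (fun x y => BY (f x) (f y)).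
Proof.
move=> fB lf; split=> [x y z|r x y|a x y|x y|x].
- by rewrite linD // formDl.
- by rewrite linZ // formZl.
- by rewrite !linZ // formJ.
- exact: formC.
- exact: form_ge0.
Qed.

Lemma psd_form_add B B' :
  psd_form B -> psd_form B' -> psd_form (fun x y => B x y + B' x y).
Proof.
move=> f f'; split=> [x y z|r x y|a x y|x y|x].
- by rewrite !formDl // addrACA.
- by rewrite !formZl // mulrDr.
- by congr (_ + _); exact: formJ.
- by congr (_ + _); exact: formC.
- by rewrite addr_ge0 // form_ge0.
Qed.

Lemma psd_form_sub B B' : psd_form B -> psd_form B' ->
  (forall x, B' x x <= B x x) -> psd_form (fun x y => B x y - B' x y).
Proof.
move=> f f' le; split=> [x y z|r x y|a x y|x y|x].
- by rewrite !formDl // opprD addrACA.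
- by rewrite !formZl // mulrBr.
- by congr (_ - _); exact: formJ.
- by congr (_ - _); exact: formC.
- by rewrite subr_ge0.
Qed.

Lemma psd_form_scale B c : psd_form B -> 0 <= c -> psd_form (fun x y => c * B x y).
Proof.
move=> f c0; split=> [x y z|r x y|a x y|x y|x].
- by rewrite formDl // mulrDr.
- by rewrite formZl // mulrCA.
- by congr (_ * _); exact: formJ.
- by congr (_ * _); exact: formC.
- by rewrite mulr_ge0 // form_ge0.
Qed.

End FormConstructions.

Section Splitting.
Variables (R : realType) (H : lmodType R[i]) (B : H -> H -> R) (V : H -> H).
Hypothesis hB : hilbert_form B.
Hypothesis lV : lin V.
Hypothesis iV : forall x, B (V x) (V x) = B x x.

(* [V \o f] is the projection onto [ran V], orthogonal for the form [c' * B - Q]. *)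
Lemma dominating_left_inverse (Q : H -> H -> R) (c c' : R) :
  psd_form Q -> (forall x, Q (V x) (V x) <= Q x x) ->
  (forall x, Q x x <= c * B x x) -> 0 <= c -> c < c' ->
  exists f : H -> H, [/\ lin f, forall x, f (V x) = x &
    forall x, Q x x + (Q (f x) (f x) - Q (V (f x)) (V (f x))) <= c' * B x x].
Proof.
move=> fQ QV Qc c0 cc'; have fB := hf_form hB.
have c'0 : 0 <= c' by lra.
have B0 x : 0 <= B x x by exact: form_ge0.
have Qc' x : Q x x <= c' * B x x.
  by apply: le_trans (Qc x) _; rewrite ler_wpM2r // ltW.
pose r x y := c' * B x y - Q x y.
have fr : psd_form r by apply: psd_form_sub => //; exact: psd_form_scale.
pose b x y := r (V x) (V y).
have fb : psd_form b by exact: psd_form_comp.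
(* The strict gap [c < c'] makes [b] equivalent to [B], as Riesz representation requires. *)
have hb : hilbert_form b.
  apply: (hilbert_form_equiv (d := c' - c) (M := c') hB fb); first by rewrite subr_gt0.
    by move=> x; rewrite /b /r iV; have := Qc (V x); rewrite iV; lra.
  by move=> x; rewrite /b /r iV; have := form_ge0 fQ (V x); lra.
(* The normal equation [b y (f x) = r x (V y)] for the [r]-closest point [V (f x)] to [x]. *)
have [|||||f [lf fG _]] :=
  @riesz_op _ _ _ B b (fun x y => r x (V y)) c' fB hb _ _ _ _ c'0.
- by move=> x x' y; rewrite formDl.
- by move=> a x y; rewrite formJ // linZ.
- by move=> x y y'; rewrite linD // formDr.
- by move=> k x y; rewrite linZ // formZr.
- move=> x y; apply: le_trans (form_CS fr _ _) _.
  by rewrite ler_wpM2r ?(form_ge0 fb) // /r; have := form_ge0 fQ x; lra.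
exists f; split=> // [x|x].
  by apply: (hilbert_form_inj hb) => y; rewrite fG /b (formC fr).
(* The projection shrinks [r], so [c' B x x - Q x x >= c' B (f x) (f x) - Q (V (f x)) (V (f x))];
   then [Q <= c' B] is used at [f x]. *)
have := form_ge0 fr (x - V (f x)); rewrite formBsqr // -fG /b /r iV.
have := Qc' (f x); lra.
Qed.

(* Iterating the previous lemma on [Q + (Q - Q \o V) \o f], whose defect along [V] is the
   old one composed with [f], yields maps with [f n.+1 \o V = f n]; they replace the
   non-existent powers [V^-n]. *)
Lemma exists_coherent_left_inverses (q : H -> H -> R) (C : R) :
  psd_form q -> (forall x, q (V x) (V x) <= q x x) ->
  (forall x, q x x <= C * B x x) -> 0 <= C ->
  exists f : nat -> H -> H, [/\ forall n, lin (f n), f 0%N = id,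
    forall n x, f n.+1 (V x) = f n x &
    forall n x, q x x + \sum_(i < n) (q (f i.+1 x) (f i.+1 x)
      - q (V (f i.+1 x)) (V (f i.+1 x))) <= (C + 1) * B x x].
Proof.
move=> fq qV qC C0; have fB := hf_form hB.
(* Strictly increasing from [C] and below [C + 1]: each stage has the strict gap it needs, within a
   uniform bound. *)
pose c n : R := C + (1 - n.+1%:R^-1).
have cS n : c n < c n.+1.
  by rewrite ltrD2l ltrD2l ltrN2 ltf_pV2 ?posrE // ltr_nat.
have c0 n : 0 <= c n.
  by rewrite addr_ge0 // subr_ge0 invf_le1 ?ler1n.
pose ok n Q := [/\ psd_form Q, forall x, Q (V x) (V x) <= Q x x &
  forall x, Q x x <= c n * B x x].
(* The choice is total, with default [id] on bad forms, so that [Q] can be defined by recursion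
   before its invariant [ok] is known. *)
have /choice[P PP] (u : nat * (H -> H -> R)) : exists f : H -> H, ok u.1 u.2 ->
    [/\ lin f, forall x, f (V x) = x &
      forall x, u.2 x x + (u.2 (f x) (f x) - u.2 (V (f x)) (V (f x)))
        <= c u.1.+1 * B x x].
  have [[fQ QV Qc]|nok] := pselect (ok u.1 u.2); last by exists id.
  by have [f fP] := dominating_left_inverse fQ QV Qc (c0 _) (cS _); exists f.
pose fix Q n : H -> H -> R := if n is m.+1 then fun x y =>
  Q m x y + (Q m (P (m, Q m) x) (P (m, Q m) y)
    - Q m (V (P (m, Q m) x)) (V (P (m, Q m) y))) else q.
pose g n := P (n, Q n).
have QS n x : Q n.+1 x x = Q n x x + (Q n (g n x) (g n x) - Q n (V (g n x)) (V (g n x))).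
  by [].
have okQ n : ok n (Q n).
  elim: n => [|n IH].
    by split=> // x; rewrite (_ : c 0%N = C) // /c invr1; lra.
  have [lg gV gc] := PP (n, Q n) IH; case: (IH) => fQ QV Qc; split.
  - apply: psd_form_add => //.
    apply: (@psd_form_comp _ _ _ (fun x y => Q n x y - Q n (V x) (V y))) => //.
    by apply: psd_form_sub => //; exact: psd_form_comp.
  (* Since [g n (V x) = x], the new form at [V x] collapses to [Q n x x]. *)
  - move=> x; rewrite [leLHS](_ : _ = Q n x x) ?QS ?lerDl ?subr_ge0 //.
    by rewrite [g n (V x)]gV addrC subrK.
  - exact: gc.
have gP n : [/\ lin (g n), forall x, g n (V x) = x & _] := PP (n, Q n) (okQ n).
pose fix f n : H -> H := if n is m.+1 then fun x => f m (g m x) else id.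
have lf n : lin (f n).
  by elim: n => [|n IH] //=; apply: lin_comp => //; have [] := gP n.
have D n x : Q n x x - Q n (V x) (V x) = q (f n x) (f n x) - q (V (f n x)) (V (f n x)).
  elim: n x => [|n IH] x //.
  rewrite !QS; have [_ gV _] := gP n; rewrite gV /= -IH; lra.
have Qsum n x : Q n x x = q x x + \sum_(i < n) (q (f i.+1 x) (f i.+1 x)
    - q (V (f i.+1 x)) (V (f i.+1 x))).
  elim: n => [|n IH]; first by rewrite big_ord0 addr0.
  by rewrite QS D big_ord_recr [RHS]addrA; congr (_ + _); exact: IH.
exists f; split=> //.
- elim=> [|n IH] x /=; first by have [_ -> _] := gP 0%N.
  by have [_ -> _] := gP n.+1.
- move=> n x; rewrite -Qsum; have [_ _ Qc] := okQ n.
  apply: le_trans (Qc x) _; rewrite ler_wpM2r ?form_ge0 // /c lerD2l.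
  by rewrite lerBlDr lerDl invr_ge0.
Qed.

(* An isometry is projective among operators similar to contractions: this is commutant
   lifting.  Formally [W = \sum_i T^i Y V^-(i+1)]. *)
Lemma exists_splitting (K : lmodType R[i]) (p : K -> K -> R) (q : H -> H -> R)
    (T : K -> K) (Y : H -> K) (C : R) :
  hilbert_form p -> qbounded p p T -> lin Y -> psd_form q ->
  (forall x, q x x <= C * B x x) -> 0 <= C ->
  (forall k h, p (T k + Y h) (T k + Y h) + q (V h) (V h) <= p k k + q h h) ->
  exists W : H -> K, qbounded B p W /\ forall h, W (V h) = T (W h) + Y h.
Proof.
move=> hp bT lY fq qC C0 contr; have fp := hf_form hp; have [lT _] := bT.
have qV x : q (V x) (V x) <= q x x.
  have := contr 0 x; have := form_ge0 fp (T 0 + Y x); rewrite (form0l fp); lra.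
have [f [lf f0 fS fsum]] := exists_coherent_left_inverses fq qV qC C0.
have sumS n (h : nat -> H) : \sum_(i < n.+1) iter i T (Y (h i)) =
    T (\sum_(i < n) iter i T (Y (h i.+1))) + Y (h 0%N).
  by rewrite big_ord_recl addrC (lin_sum lT _ (fun i => iter i T (Y (h i.+1)))).
(* Energy estimate along the Horner scheme [sumS]: each application of [T] and [Y] costs at most the
   defect of [q] at the vector just added. *)
have psum n (h : nat -> H) :
    p (\sum_(i < n) iter i T (Y (h i))) (\sum_(i < n) iter i T (Y (h i))) <=
    \sum_(i < n) (q (h i) (h i) - q (V (h i)) (V (h i))).
  elim: n h => [|n IH] h; first by rewrite !big_ord0 form0l.
  rewrite sumS big_ord_recl.
  have := contr (\sum_(i < n) iter i T (Y (h i.+1))) (h 0%N).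
  have := IH (fun i => h i.+1); lra.
pose Z n h := \sum_(i < n) iter i T (Y (f i.+1 h)).
have lTf n i : lin (fun h => iter i T (Y (f n h))).
  by apply: lin_comp (lin_comp lY (lf n)); exact: lin_iter.
apply: (@intertwiner_of_bounded_seq _ _ _ B p T V Y Z (C + 1)) => //.
- exact: hf_form hB.
- by move=> n; exact: (@lin_bigsum _ _ _ n (fun i h => iter i T (Y (f i.+1 h)))).
- by rewrite addr_ge0.
- move=> n h; apply: le_trans (psum n (fun i => f i.+1 h)) _.
  by apply: le_trans (fsum n h); rewrite lerDr (form_ge0 fq).
- move=> n h; rewrite /Z (sumS n (fun i => f i.+1 (V h))) fS f0.
  by congr (T _ + _); apply: eq_bigr => i _; rewrite fS.
Qed.

End Splitting.

(** * Similarity and splitting *)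

Section InnerProducts.
Variable R : realType.

Definition re_ip (X : lmodType R[i]) (ip : X -> X -> R[i]) (x y : X) : R :=
  complex.Re (ip x y).

Lemma hilbert_form_re_ip (X : lmodType R[i]) (ip : X -> X -> R[i]) :
  is_hilbert ip -> hilbert_form (re_ip ip).
Proof.
case=> ipl ipc ip0 ipd ipC.
have Dl x y z : ip (x + y) z = ip x z + ip y z.
  by have := ipl 1 x y z; rewrite scale1r mul1r.
have Zl a x z : ip (a *: x) z = a * ip x z.
  have z0 : ip 0 z = 0 by apply: (addrI (ip 0 z)); rewrite -Dl !addr0.
  by have := ipl a x 0 z; rewrite z0 !addr0.
have Zr a x z : ip x (a *: z) = a^* * ip x z.
  by rewrite ipc Zl rmorphM [ip x z]ipc.
have ge0 x : 0 <= re_ip ip x x.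
  by have := ip0 x; rewrite lecE /= => /andP[_].
split.
- split=> // [x y z|r x y|a x y|x y]; rewrite /re_ip.
  + by rewrite Dl raddfD.
  + by rewrite Zl; case: (ip x y) => p q /=; rewrite mul0r subr0.
  + by rewrite Zl Zr conjCK.
  + by rewrite ipc; case: (ip y x).
- move=> x x0; apply: ipd; apply/eqP; rewrite eq_complex; apply/andP; split; apply/eqP.
    exact: x0.
  by have := ip0 x; rewrite lecE /= => /andP[/eqP].
- have ltE x (e : R) : 0 < e -> (hnorm ip x < e) = (re_ip ip x x < e ^+ 2).
    by move=> e0; rewrite -[in LHS](ger0_norm (ltW e0)) -sqrtr_sqr ltr_sqrt ?exprn_gt0.
  move=> u cu; have [|l ul] := ipC u.
    move=> e e0; have [N uN] := cu _ (exprn_gt0 2 e0).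
    by exists N => m n Nm Nn; rewrite ltE //; exact: uN.
  exists l => e e0; have s0 : 0 < Num.sqrt e by rewrite sqrtr_gt0.
  have [N uN] := ul _ s0; exists N => n Nn.
  by have := uN n Nn; rewrite ltE // sqr_sqrtr // ltW.
Qed.

Section Norms.
Variables (X Y : lmodType R[i]) (ipX : X -> X -> R[i]) (ipY : Y -> Y -> R[i]).
Hypothesis pX : forall x, 0 <= re_ip ipX x x.
Hypothesis pY : forall y, 0 <= re_ip ipY y y.

Lemma hnorm_sqr x : hnorm ipX x ^+ 2 = re_ip ipX x x.
Proof. by rewrite /hnorm sqr_sqrtr //; exact: pX. Qed.

Lemma ler_hnorm x y : (hnorm ipY y <= hnorm ipX x) = (re_ip ipY y y <= re_ip ipX x x).
Proof. by rewrite /hnorm ler_sqrt //; exact: pX. Qed.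

Lemma hnorm_le_mul (M : R) x y :
  hnorm ipY y <= M * hnorm ipX x -> re_ip ipY y y <= M ^+ 2 * re_ip ipX x x.
Proof.
move=> le; have n0 : 0 <= hnorm ipY y by exact: sqrtr_ge0.
rewrite -hnorm_sqr -[leLHS](sqr_sqrtr (pY y)) -exprMn lerXn2r // nnegrE //.
exact: le_trans le.
Qed.

Lemma re_le_mul (M : R) x y : 0 <= M ->
  re_ip ipY y y <= M * re_ip ipX x x -> hnorm ipY y <= Num.sqrt M * hnorm ipX x.
Proof. by move=> M0 le; rewrite /hnorm -sqrtrM // ler_wsqrtr. Qed.

Lemma qbounded_of_bounded_op f :
  bounded_op ipX ipY f -> qbounded (re_ip ipX) (re_ip ipY) f.
Proof.
move=> [lf [M fM]]; split=> //; exists (M ^+ 2); first exact: sqr_ge0.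
by move=> x; exact: hnorm_le_mul.
Qed.

Lemma bounded_op_of_qbounded f :
  qbounded (re_ip ipX) (re_ip ipY) f -> bounded_op ipX ipY f.
Proof.
move=> [lf [M M0 fM]]; split=> //; exists (Num.sqrt M) => x.
exact: re_le_mul.
Qed.

End Norms.

(** Multiplying [x] by the conjugate of [ip (V x) h] turns the real part into a squared modulus. *)
Lemma in_ker_adj_re (H : lmodType R[i]) (ip : H -> H -> R[i]) (V : H -> H) h :
  is_hilbert ip -> lin V -> (forall x, re_ip ip (V x) h = 0) -> in_ker_adj ip V h.
Proof.
move=> hip lV h0 x.
have Zl a y z : ip (a *: y) z = a * ip y z.
  have ipl := ip_linear hip.
  have z0 : ip 0 z = 0 by have := ipl (-1) 0 0 z; rewrite scaler0 addr0 mulN1r addNr.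
  by have := ipl a y 0 z; rewrite z0 !addr0.
have := h0 ((ip (V x) h)^* *: x); rewrite /re_ip linZ // Zl.
case: (ip (V x) h) => p q /= e.
have [p0 q0] : p = 0 /\ q = 0.
  have : p ^+ 2 + q ^+ 2 = 0 by rewrite -e; ring.
  move/eqP; rewrite paddr_eq0 ?sqr_ge0 // !sqrf_eq0.
  by move=> /andP[/eqP -> /eqP ->].
by rewrite p0 q0.
Qed.

Definition prod_form (K H : lmodType R[i]) (BK : K -> K -> R) (BH : H -> H -> R)
  (p q : (K * H)%type) : R := BK p.1 q.1 + BH p.2 q.2.

Lemma re_ip_sum (K H : lmodType R[i]) (ipK : K -> K -> R[i]) (ipH : H -> H -> R[i]) :
  re_ip (ip_sum ipK ipH) = prod_form (re_ip ipK) (re_ip ipH).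
Proof. by apply/funext => p; apply/funext => q; rewrite /re_ip raddfD. Qed.

Lemma hilbert_form_prod (K H : lmodType R[i]) (BK : K -> K -> R) (BH : H -> H -> R) :
  hilbert_form BK -> hilbert_form BH -> hilbert_form (prod_form BK BH).
Proof.
move=> hK hH; have fK := hf_form hK; have fH := hf_form hH.
have K0 x : 0 <= BK x x by exact: form_ge0.
have H0 x : 0 <= BH x x by exact: form_ge0.
split.
- have lfst : lin (fst : (K * H)%type -> K) by [].
  have lsnd : lin (snd : (K * H)%type -> H) by [].
  exact: psd_form_add (psd_form_comp fK lfst) (psd_form_comp fH lsnd).
- move=> [k h]; rewrite /prod_form /= => /eqP; rewrite paddr_eq0 // => /andP[/eqP k0 /eqP h0].
  by rewrite (hf_eq0 hK k0) (hf_eq0 hH h0).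
- move=> u cu; have [|k uk] := hf_complete hK (u := fun n => (u n).1).
    move=> e e0; have [N uN] := cu e e0; exists N => m n Nm Nn.
    by apply: le_lt_trans (uN m n Nm Nn); rewrite lerDl.
  have [|h uh] := hf_complete hH (u := fun n => (u n).2).
    move=> e e0; have [N uN] := cu e e0; exists N => m n Nm Nn.
    by apply: le_lt_trans (uN m n Nm Nn); rewrite lerDr.
  exists (k, h) => e e0; have e2 : 0 < e / 2 by rewrite divr_gt0.
  have [N1 h1] := uk _ e2; have [N2 h2] := uh _ e2.
  exists (maxn N1 N2) => n; rewrite geq_max => /andP[n1 n2].
  by rewrite [ltRHS]splitr ltrD //; [exact: h1 | exact: h2].
Qed.

End InnerProducts.

Section Similarity.
Variables (R : realType) (K H : lmodType R[i]) (BK : K -> K -> R) (BH : H -> H -> R).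
Variables (T : K -> K) (V : H -> H) (X : H -> K).
Hypotheses (hK : hilbert_form BK) (hH : hilbert_form BH).
Hypotheses (bT : qbounded BK BK T) (bX : qbounded BH BK X) (lV : lin V).
Hypothesis iV : forall h, BH (V h) (V h) = BH h h.
Local Notation BS := (prod_form BK BH).

(** [g] is the norm in which [Rop T V X] is a contraction. Replacing the summand H by the
    [g]-orthogonal complement of K, the graph of [Z0], reduces the claim to [exists_splitting]. *)
Lemma splitting_of_similar (S Si : (K * H)%type -> (K * H)%type) :
  qbounded BS BS S -> qbounded BS BS Si -> (forall p, S (Si p) = p) ->
  (forall p, BS (Si (Rop T V X (S p))) (Si (Rop T V X (S p))) <= BS p p) ->
  exists W : H -> K, qbounded BH BK W /\ forall h, X h = T (W h) - W (V h).
Proof.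
move=> [lS [M M0 SM]] [lSi [N N0 SN]] SSi contr.
have fK := hf_form hK; have fH := hf_form hH.
have fS : psd_form BS := hf_form (hilbert_form_prod hK hH).
have [lT [MT MT0 TM]] := bT; have [lX _] := bX.
pose g p p' := BS (Si p) (Si p').
have fg : psd_form g by exact: psd_form_comp.
have gR p : g (Rop T V X p) (Rop T V X p) <= g p p by rewrite /g -{1 2}(SSi p) contr.
have gN p : g p p <= N * BS p p by exact: SN.
have gM p : BS p p <= M * g p p by rewrite /g -{1 2}(SSi p) SM.
have lK := @lin_inl _ K H; have lH := @lin_inr _ K H.
pose pK k k' := g (k, 0) (k', 0).
have fp : psd_form pK := psd_form_comp fg lK.
have BSK k : BS (k, 0) (k, 0) = BK k k by rewrite /prod_form /= (form0l fH) addr0.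
have BSH h : BS (0, h) (0, h) = BH h h by rewrite /prod_form /= (form0l fK) add0r.
have pN k : pK k k <= N * BK k k by rewrite -BSK; exact: gN.
have M1 : 0 < M + 1 by rewrite ltr_wpDl.
have pM k : BK k k <= (M + 1) * pK k k.
  by have := gM (k, 0); rewrite BSK; have := form_ge0 fp k; rewrite /pK; lra.
have hp : hilbert_form pK.
  apply: (hilbert_form_equiv (d := (M + 1)^-1) hK fp _ _ pN); first by rewrite invr_gt0.
  by move=> k; rewrite ler_pdivrMl.
(* [(Z0 h, h)] is the vector of least [g]-length above [h]. *)
have [|||||Z0 [lZ0 Z0G Z0N]] :=
  @riesz_op _ _ _ BH pK (fun h k => - g (k, 0) (0, h)) N fH hp _ _ _ _ N0.
- by move=> h h' k; rewrite (linD lH) (formDr fg) opprD.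
- by move=> a h k; rewrite (linZ lH) (linZ lK) (formJr fg).
- by move=> h k k'; rewrite (linD lK) (formDl fg) opprD.
- by move=> r h k; rewrite (linZ lK) (formZl fg) mulrN.
- move=> h k; rewrite sqrrN; apply: le_trans (form_CS fg _ _) _.
  by rewrite mulrC ler_wpM2r ?(form_ge0 fp) // -BSH; exact: gN.
pose G h := (Z0 h, h).
have lG : lin G by move=> a h h'; rewrite /G lZ0.
pose q h h' := g (G h) (G h').
have fq : psd_form q := psd_form_comp fg lG.
have gE k h : g (k + Z0 h, h) (k + Z0 h, h) = pK k k + q h h.
  have -> : (k + Z0 h, h) = (k, 0) + G h by congr pair; rewrite /= add0r.
  rewrite formDsqr // (_ : g (k, 0) (G h) = 0) ?mulr0 ?addr0 //.
  have -> : G h = (Z0 h, 0) + (0, h) by congr pair; rewrite /= ?addr0 ?add0r.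
  by rewrite formDr // -[g (k, 0) (Z0 h, 0)]/(pK k (Z0 h)) Z0G addNr.
have qN h : q h h <= N * BH h h.
  have := gE (- Z0 h) h; rewrite addNr; have := gN (0, h); rewrite BSH.
  by have := form_ge0 fp (- Z0 h); lra.
(* The corner of [Rop T V X] in the coordinates [(k + Z0 h, h)]. *)
pose Y h := X h + T (Z0 h) - Z0 (V h).
have lY : lin Y.
  by apply: lin_add (lin_add lX (lin_comp lT lZ0)) (lin_opp (lin_comp lZ0 lV)).
have bTp : qbounded pK pK T.
  split=> //; exists (N * MT * (M + 1)) => [|k].
    by rewrite !mulr_ge0 // ltW.
  apply: le_trans (pN _) _; rewrite -!mulrA ler_wpM2l //.
  by apply: le_trans (TM _) _; rewrite ler_wpM2l.
have contrY k h : pK (T k + Y h) (T k + Y h) + q (V h) (V h) <= pK k k + q h h.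
  rewrite -!gE; have := gR (k + Z0 h, h); rewrite /Rop /= (linD lT).
  by rewrite /Y (_ : T k + _ + _ = T k + T (Z0 h) + X h) // addrA subrK addrA addrAC.
have [W [[lW [C C0 WC]] WV]] := exists_splitting hH lV iV hp bTp lY fq qN N0 contrY.
have bZ0 : qbounded BH BK Z0.
  split=> //; exists ((M + 1) * N) => [|h]; first by rewrite mulr_ge0 // ltW.
  by apply: le_trans (pM _) _; rewrite -mulrA ler_pM2l.
have bW : qbounded BH BK W.
  split=> //; exists ((M + 1) * C) => [|h]; first by rewrite mulr_ge0 // ltW.
  by apply: le_trans (pM _) _; rewrite -mulrA ler_pM2l.
(* [Z0] undoes the change of coordinates; the sign comes from the convention [W V = T W + Y]. *)
exists (fun h => - (W h + Z0 h)); split.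
  exact/qbounded_opp/qbounded_add.
move=> h; rewrite WV (linN lT) (linD lT) /Y opprK.
by rewrite -[_ + _ + Z0 (V h)]addrA subrK (addrCA (T (W h)) (X h)) [RHS]addrC addrK.
Qed.

(** The shear by [W] conjugates [Rop T V X] to the direct sum of [T] and [V], a contraction because
    both summands are. *)
Lemma similar_of_splitting (W : H -> K) : qbounded BH BK W ->
  (forall k, BK (T k) (T k) <= BK k k) ->
  (forall h, X h = T (W h) - W (V h)) ->
  exists S Si : (K * H)%type -> (K * H)%type,
    [/\ qbounded BS BS S, qbounded BS BS Si, (forall p, S (Si p) = p),
      (forall p, Si (S p) = p) &
      forall p, BS (Si (Rop T V X (S p))) (Si (Rop T V X (S p))) <= BS p p].
Proof.
move=> bW cT XW; have [lT _] := bT.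
have fK := hf_form hK; have fH := hf_form hH.
have shear U : qbounded BH BK U -> qbounded BS BS (fun p => (p.1 + U p.2, p.2)).
  move=> [lU [M M0 UM]]; split.
    by move=> a p p'; congr pair; rewrite /= lU scalerDr addrACA.
  exists (2 + 2 * M) => [|[k h]]; first by rewrite addr_ge0 ?mulr_ge0.
  rewrite /prod_form /=; have := formD_le fK k (U h); have := UM h.
  have := form_ge0 fK k; have := form_ge0 fH h.
  by have := mulr_ge0 M0 (form_ge0 fK k); have := mulr_ge0 M0 (form_ge0 fH h); lra.
have [lW _] := bW.
exists (fun p => (p.1 - W p.2, p.2)), (fun p => (p.1 + W p.2, p.2)); split.
- exact: (shear _ (qbounded_opp fK bW)).
- exact: shear.
- by case=> k h /=; rewrite addrK.
- by case=> k h /=; rewrite subrK.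
- case=> k h; rewrite /Rop /prod_form /= iV lerD2r XW linB //.
  by rewrite addrA subrK subrK.
Qed.

End Similarity.

(** * Quadratic nearness and splitting *)

Section Corners.
Variables (R : realType) (K H : lmodType R[i]).
Variables (T : K -> K) (V : H -> H) (Y : H -> K).
Hypotheses (lT : lin T) (lV : lin V) (lY : lin Y).

(** The upper right entry of the n-th power, that is the sum of [T^(n-1-i) Y V^i] over [i < n]. *)
Definition corner n h := (iter n (Rop T V Y) (0, h)).1.

Lemma iter_Rop_snd n p : (iter n (Rop T V Y) p).2 = iter n V p.2.
Proof. by elim: n => //= n ->. Qed.

Lemma cornerS n h : corner n.+1 h = T (corner n h) + Y (iter n V h).
Proof. by rewrite /corner /= iter_Rop_snd. Qed.

Lemma lin_corner n : lin (corner n).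
Proof.
elim: n => [|n IH] a x y; first by rewrite /corner /= scaler0 addr0.
by rewrite !cornerS IH lT (lin_iter n lV) lY scalerDr addrACA.
Qed.

Lemma corner_coboundary (W : H -> K) n h : lin W ->
  (forall x, Y x = T (W x) - W (V x)) -> corner n h = iter n T (W h) - W (iter n V h).
Proof.
move=> lW YW; elim: n => [|n IH]; first by rewrite /corner /= subrr.
by rewrite cornerS IH YW (linB lT) addrA subrK.
Qed.

End Corners.

Section WanderingSpace.
Variables (R : realType) (H : lmodType R[i]) (B : H -> H -> R) (V : H -> H).
Hypotheses (fB : psd_form B) (lV : lin V) (iV : forall h, B (V h) (V h) = B h h).

Lemma wandering_sum_sqr n (l : nat -> H) :
  (forall i, (i < n)%N -> forall x, B (V x) (l i) = 0) ->
  B (\sum_(i < n) iter i V (l i)) (\sum_(i < n) iter i V (l i)) =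
  \sum_(i < n) B (l i) (l i).
Proof.
elim: n l => [|n IH] l l0; first by rewrite !big_ord0 form0l.
rewrite !big_ord_recl -(lin_sum lV _ (fun i => iter i V (l i.+1))) formDsqr // iV.
rewrite /= [B (l _) (V _)](formC fB) l0 // mulr0 addr0; congr (_ + _).
by apply: (IH (fun i => l i.+1)) => i ni x; rewrite l0.
Qed.

End WanderingSpace.

(* Quadratic nearness modulo [ker V^*], with the constant squared. *)
Definition wandering_bounded (R : realType) (K H : lmodType R[i]) (BK : K -> K -> R)
    (BH : H -> H -> R) (T : K -> K) (V : H -> H) (A : H -> K) := exists2 c : R, 0 <= c &
  forall n (l : nat -> H), (forall i, (i < n)%N -> forall x, BH (V x) (l i) = 0) ->
    BK (\sum_(i < n) corner T V A i (l i)) (\sum_(i < n) corner T V A i (l i))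
      <= c * \sum_(i < n) BH (l i) (l i).

Section QuadraticNearness.
Variables (R : realType) (K H : lmodType R[i]).
Variables (ipK : K -> K -> R[i]) (ipH : H -> H -> R[i]).
Hypotheses (hK : is_hilbert ipK) (hH : is_hilbert ipH).
Variables (T : K -> K) (V : H -> H) (A : H -> K).
Hypotheses (lT : lin T) (lV : lin V).
Local Notation BK := (re_ip ipK).
Local Notation BH := (re_ip ipH).

(** Both powers act as [V^i] on the second coordinate and [Rop T V 0] has zero corners, so on
    [(0, l)] their difference is [(corner i l, 0)]. *)
Lemma quad_nearP : quad_near_mod_ker ipK ipH T V A <-> wandering_bounded BK BH T V A.
Proof.
have hBK := hilbert_form_re_ip hK; have hBH := hilbert_form_re_ip hH.
have fK := hf_form hBK; have fH := hf_form hBH.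
have H0 h : 0 <= BH h h by exact: form_ge0.
have K0 k : 0 <= BK k k by exact: form_ge0.
have sumE n (l : nat -> H) :
    \sum_(i < n) (iter i (Rop T V A) (0, l i) - iter i (Rop T V (fun=> 0)) (0, l i)) =
    (\sum_(i < n) corner T V A i (l i), 0).
  rewrite [RHS](lin_sum (@lin_inl _ K H) n (fun i => corner T V A i (l i))); apply: eq_bigr => i _.
  rewrite [iter i _ _]surjective_pairing iter_Rop_snd.
  rewrite [iter i (Rop T V (fun=> 0)) _]surjective_pairing iter_Rop_snd.
  rewrite -/(corner T V (fun=> 0) i (l i)) (@corner_coboundary _ _ _ _ _ _ lT (fun=> 0)).
  - rewrite (lin0 (lin_iter i lT)) subr0.
    by congr pair; rewrite /= ?subr0 ?subrr.
  - by move=> a x y; rewrite scaler0 addr0.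
  - by move=> x; rewrite lin0 // subr0.
have normE k : hnorm (ip_sum ipK ipH) (k, 0) = Num.sqrt (BK k k).
  by rewrite /hnorm -/(re_ip _ _ _) re_ip_sum /prod_form /= (form0l fH) addr0.
have sqrE h : hnorm (ip_sum ipK ipH) (0, h) ^+ 2 = BH h h.
  rewrite /hnorm -/(re_ip _ _ _) re_ip_sum /prod_form /= (form0l fK) add0r.
  exact: sqr_sqrtr.
split=> [[s sP]|[c c0 cP]].
  (* Quadratic nearness sums over [N + 1] vectors, so the empty sum is treated separately. *)
  exists (s ^+ 2) => [|[|n] l l0]; first exact: sqr_ge0.
    by rewrite !big_ord0 (form0l fK) mulr0.
  have := sP n (fun i => (0, l i)) (fun i ni => conj erefl (in_ker_adj_re hH lV (l0 i ni))).
  rewrite sumE normE; under [X in _ * Num.sqrt X]eq_bigr do rewrite sqrE.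
  set a := BK _ _; set b := \sum_(i < _) _ => le.
  have b0 : 0 <= b by exact: sumr_ge0.
  rewrite -[leLHS](sqr_sqrtr (K0 _)) -[X in _ <= _ * X](sqr_sqrtr b0) -exprMn.
  by rewrite lerXn2r ?nnegrE ?sqrtr_ge0 // (le_trans _ le) ?sqrtr_ge0.
exists (Num.sqrt c) => N x xP.
have xE i : (i <= N)%N -> x i = (0, (x i).2).
  by move=> /xP[x0 _]; rewrite [LHS]surjective_pairing x0.
rewrite (eq_bigr (fun i : 'I_N.+1 => iter i (Rop T V A) (0, (x i).2)
    - iter i (Rop T V (fun=> 0)) (0, (x i).2))); last first.
  by move=> i _; rewrite -xE // -ltnS.
rewrite (sumE _ (fun i => (x i).2)) normE -sqrtrM //; apply: ler_wsqrtr.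
rewrite (eq_bigr (fun i : 'I_N.+1 => BH (x i).2 (x i).2)); last first.
  by move=> i _; rewrite [in LHS]xE ?sqrE // -ltnS.
apply: (cP _ (fun i => (x i).2)) => i iN y.
by have [_] := xP i iN; rewrite /in_ker_adj /re_ip => ->.
Qed.

End QuadraticNearness.

Section QuadraticCriterion.
Variables (R : realType) (K H : lmodType R[i]) (BK : K -> K -> R) (BH : H -> H -> R).
Variables (T : K -> K) (V : H -> H) (X : H -> K).
Hypotheses (hK : hilbert_form BK) (hH : hilbert_form BH).
Hypotheses (bT : qbounded BK BK T) (cT : forall k, BK (T k) (T k) <= BK k k).
Hypotheses (bV : qbounded BH BH V) (iV : forall h, BH (V h) (V h) = BH h h).
Hypothesis bX : qbounded BH BK X.

Lemma exists_isometry_adjoint : exists Vs : H -> H,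
  [/\ qbounded BH BH Vs, forall x y, BH x (Vs y) = BH (V x) y,
      forall x, Vs (V x) = x & forall x, BH (Vs x) (Vs x) <= BH x x].
Proof.
have fH := hf_form hH; have [lV _] := bV.
have V1 x : BH (V x) (V x) <= 1 * BH x x by rewrite iV mul1r.
have [Vs [lVs VsE Vs1]] := exists_adjoint hH fH lV ler01 V1.
exists Vs; split=> //.
- by split=> //; exists 1.
- move=> x; apply: (hilbert_form_inj hH) => y; rewrite VsE.
  (* Polarising the isometry identity gives [V^* V = 1]. *)
  have := iV (x + y); rewrite (linD lV) !formDsqr // !iV (formC fH (V y)) (formC fH y).
  lra.
- by move=> x; rewrite -[leRHS]mul1r.
Qed.

(** [U] agrees with [W] on [ran V] and vanishes on [ker V^*]. On wandering vectors the corner sum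
    therefore telescopes to [- U] of an orthogonal sum. *)
Lemma wandering_bounded_of_splitting (W : H -> K) :
  qbounded BH BK W -> (forall h, X h = T (W h) - W (V h)) ->
  exists A : H -> K, [/\ qbounded BH BK A, forall h, A (V h) = X (V h) &
    wandering_bounded BK BH T V A].
Proof.
move=> bW XW; have fK := hf_form hK; have fH := hf_form hH.
have [lV _] := bV; have [lT _] := bT.
have [Vs [bVs VsE VsV _]] := exists_isometry_adjoint.
pose U h := W (V (Vs h)).
have bU : qbounded BH BK U by exact: qbounded_comp bW (qbounded_comp bV bVs).
exists (fun h => T (U h) - U (V h)); split.
- apply: qbounded_add => //; first exact: qbounded_comp bT bU.
  by apply: qbounded_opp => //; exact: qbounded_comp bU bV.
- by move=> h; rewrite /U !VsV XW.
have [lU [M M0 UM]] := bU; exists M => // n l l0.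
have -> : \sum_(i < n) corner T V (fun h => T (U h) - U (V h)) i (l i) =
    - U (\sum_(i < n) iter i V (l i)).
  rewrite (lin_sum lU _ (fun i => iter i V (l i))) -sumrN; apply: eq_bigr => i _.
  rewrite (corner_coboundary lT _ _ lU) // (_ : U (l i) = 0) ?(lin0 (lin_iter i lT)) ?sub0r //.
  rewrite /U (_ : Vs (l i) = 0) ?(lin0 lV) ?(lin0 bW.1) //.
  by apply: (hilbert_form_inj hH) => y; rewrite VsE l0 // form0r.
by rewrite formNsqr //; apply: le_trans (UM _) _; rewrite wandering_sum_sqr.
Qed.

Lemma splitting_of_wandering_bounded (A : H -> K) (g : K -> K) (M : R) :
  qbounded BH BK A -> (forall h, A (V h) = X (V h)) -> wandering_bounded BK BH T V A ->
  qbounded BK BK g -> (forall k, T (g k) = k) ->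
  0 <= M -> (forall n h, BK (corner T V X n h) (corner T V X n h) <= M * BH h h) ->
  exists W : H -> K, qbounded BH BK W /\ forall h, X h = T (W h) - W (V h).
Proof.
move=> bA AV [c c0 cP] bg Tg M0 XM; have fK := hf_form hK; have fH := hf_form hH.
have [lV _] := bV; have [lT _] := bT; have [lA _] := bA; have [lX _] := bX.
have [Vs [bVs VsE VsV Vs1]] := exists_isometry_adjoint; have [lVs _] := bVs.
pose F h := X h - A h.
have bF : qbounded BH BK F by exact: qbounded_add (qbounded_opp _ bA).
have [lF [N N0 FN]] := bF.
have FV h : F (V h) = 0 by rewrite /F AV subrr.
have cTn n k : BK (iter n T k) (iter n T k) <= BK k k.
  by elim: n => //= n; exact: le_trans.
pose a := corner T V A.
have la n : lin (a n) by exact: lin_corner.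
have aN n h : BK (a n h) (a n h) <= (2 * (M + N)) * BH h h.
  have H0 := form_ge0 fH h.
  case: n => [|n]; first by rewrite /a /corner (form0l fK) !mulr_ge0 // addr_ge0.
  (* [A] and [X] agree on [ran V], so the two corners differ only in the term without a power of
     [V]. *)
  have -> : a n.+1 h = corner T V X n.+1 h + - iter n T (F h).
    elim: n => [|n IH].
      by rewrite /a !cornerS /corner /F /= (lin0 lT) !add0r opprB addrCA subrr addr0.
    rewrite /a cornerS -/(a _) IH (cornerS T V X n.+1) (linD lT) (linN lT) -!addrA.
    by congr (_ + _); rewrite addrC /= AV.
  have := formD_le fK (corner T V X n.+1 h) (- iter n T (F h)); rewrite (formNsqr fK).
  have := XM n.+1 h; have := cTn n (F h); have := FN h; lra.
pose P h := h - V (Vs h).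
have lP : lin P by exact: lin_add (@lin_id _ _) (lin_opp (lin_comp lV lVs)).
have PV x h : BH (V x) (P h) = 0 by rewrite /P formDr // formNr // -!VsE VsV subrr.
have PP h : BH (P h) (P h) = BH h h - BH (Vs h) (Vs h).
  by rewrite /P formBsqr // iV (formC fH h) -VsE; ring.
have sumP n h : \sum_(i < n) BH (P (iter i Vs h)) (P (iter i Vs h)) =
    BH h h - BH (iter n Vs h) (iter n Vs h).
  elim: n => [|n IH]; first by rewrite big_ord0 subrr.
  by rewrite big_ord_recr /= IH PP; ring.
(* Finite Wold decomposition of [h]; [sumP] measures its wandering components. *)
have sumV n h : iter n V (iter n Vs h) + \sum_(i < n) iter i V (P (iter i Vs h)) = h.
  elim: n => [|n IH]; first by rewrite big_ord0 addr0.
  have e : iter n.+1 V (iter n.+1 Vs h) + iter n V (P (iter n Vs h)) =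
      iter n V (iter n Vs h).
    by rewrite iterSr (iterS n Vs) /P (linB (lin_iter n lV)) addrC subrK.
  by rewrite big_ord_recr addrCA [X in _ + X]e addrC; exact: IH.
(* On [ran V^n] the map [Z n] is minus [a n \o Vs^n], on the wandering vectors it
   sends [V^i l] to [- a i l]. *)
pose Z n h := - (a n (iter n Vs h) + \sum_(i < n) a i (P (iter i Vs h))).
have laV n : lin (fun h => a n (iter n Vs h)) by apply: lin_comp => //; exact: lin_iter.
have laP n : lin (fun h => a n (P (iter n Vs h))).
  by apply: lin_comp => //; apply: lin_comp => //; exact: lin_iter.
have Vsn n h : BH (iter n Vs h) (iter n Vs h) <= BH h h.
  by elim: n => //= n; exact: le_trans.
have [||||W [bW WV]] := @intertwiner_of_bounded_seq _ _ _ BH BK T V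
    (fun h => - A h) Z (2 * (2 * (M + N) + c)) fH hK bT.
- by move=> n; apply: lin_opp; apply: lin_add => //; exact: (lin_bigsum n laP).
- by rewrite mulr_ge0 // !addr_ge0 // mulr_ge0 // addr_ge0.
- move=> n h; rewrite /Z formNsqr //; apply: le_trans (formD_le fK _ _) _.
  rewrite -mulrA ler_wpM2l // mulrDl lerD //.
    by apply: le_trans (aN _ _) _; rewrite ler_wpM2l // mulr_ge0 // addr_ge0.
  apply: le_trans (cP n (fun i => P (iter i Vs h)) _) _; first by move=> *; exact: PV.
  by rewrite sumP ler_wpM2l // lerBlDr lerDl form_ge0.
(* Splitting [A h] along [sumV] matches it term by term with [T (Z n h)] through [cornerS]. As
   [Vs (V h) = h], indices shift by one, and the leftover term vanishes because [a 0 = 0]. *)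
- move=> n h; rewrite -[in A h](sumV n h) /Z (linN lT) -opprD; congr (- _).
  rewrite big_ord_recl (_ : a _ (P _) = 0) // add0r /= -iterS iterSr VsV.
  rewrite /a cornerS (linD lT) (linD lA) -!addrA; congr (_ + _).
  rewrite [RHS]addrCA; congr (_ + _).
  rewrite (lin_sum lT _ (fun i => a i (P (iter i Vs h)))).
  rewrite (lin_sum lA _ (fun i => iter i V (P (iter i Vs h)))) -big_split /=.
  by apply: eq_bigr => i _; rewrite -iterS iterSr VsV cornerS.
(* [W] splits [A]; [g F] splits [F = X - A], since [T g = 1] and [F V = 0]. *)
exists (fun h => W h + g (F h)); split.
  exact: qbounded_add bW (qbounded_comp bg bF).
move=> h; rewrite FV (lin0 bg.1) addr0 (linD lT) Tg WV /F.
by rewrite opprD opprK addrACA subrr add0r subrK.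
Qed.

End QuadraticCriterion.

(** * Translation to norms and the equivalence *)

Lemma similar_to_contractionP (R : realType) (X : lmodType R[i]) (ip : X -> X -> R[i])
    (f : X -> X) : (forall x, 0 <= re_ip ip x x) ->
  similar_to_contraction ip f <->
  exists S Si : X -> X,
    [/\ qbounded (re_ip ip) (re_ip ip) S, qbounded (re_ip ip) (re_ip ip) Si,
      (forall x, S (Si x) = x), (forall x, Si (S x) = x) &
      forall x, re_ip ip (Si (f (S x))) (Si (f (S x))) <= re_ip ip x x].
Proof.
move=> p0; split=> -[S [Si [bS bSi SSi SiS c]]]; exists S, Si; split=> //.
- exact: qbounded_of_bounded_op.
- exact: qbounded_of_bounded_op.
- by move=> x; rewrite -ler_hnorm.
- exact: bounded_op_of_qbounded.
- exact: bounded_op_of_qbounded.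
- by move=> x; rewrite ler_hnorm.
Qed.

Lemma power_bounded_of_similar (R : realType) (X : lmodType R[i]) (ip : X -> X -> R[i])
    (f : X -> X) : (forall x, 0 <= re_ip ip x x) ->
  similar_to_contraction ip f -> power_bounded ip f.
Proof.
move=> p0 /(similar_to_contractionP _ p0)[S [Si [[_ [M M0 SM]] [_ [N N0 SN]] SSi _ c]]].
exists (Num.sqrt (M * N)) => n x; apply: re_le_mul => //; first exact: mulr_ge0.
have -> : iter n f x = S (iter n (fun y => Si (f (S y))) (Si x)).
  by elim: n => [|n IH] /=; rewrite ?SSi // IH.
apply: le_trans (SM _) _; rewrite -mulrA ler_wpM2l //; apply: le_trans (SN x).
by elim: n => //= n; apply: le_trans.
Qed.

Theorem theorem5p2 (R : realType) (K H : lmodType R[i])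
    (ipK : K -> K -> R[i]) (ipH : H -> H -> R[i])
    (hK : is_hilbert ipK) (hH : is_hilbert ipH)
    (V : H -> H) (T : K -> K) (X : H -> K)
    (hVb : bounded_op ipH ipH V) (hV : isometry_op ipH ipH V)
    (hTb : bounded_op ipK ipK T) (hTc : contraction ipK T)
    (hTr : right_invertible ipK T)
    (hX : bounded_op ipH ipK X) :
  similar_to_contraction (ip_sum ipK ipH) (Rop T V X) <->
  (power_bounded (ip_sum ipK ipH) (Rop T V X) /\
   exists (A : H -> K) (E : (K * H)%type -> (K * H)%type),
     [/\ bounded_op ipH ipK A /\ bounded_op (ip_sum ipK ipH) (ip_sum ipK ipH) E,
         nilpotent E,
         (forall p, E (Rop T V A p) = 0),
         (forall p, Rop T V X p = Rop T V A p + E p) &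
         quad_near_mod_ker ipK ipH T V A]).
Proof.
have hBK := hilbert_form_re_ip hK; have hBH := hilbert_form_re_ip hH.
have fK := hf_form hBK; have fH := hf_form hBH.
have K0 := form_ge0 fK; have H0 := form_ge0 fH.
have S0 : forall p, 0 <= re_ip (ip_sum ipK ipH) p p.
  by rewrite re_ip_sum; exact: form_ge0 (hf_form (hilbert_form_prod hBK hBH)).
have bV := qbounded_of_bounded_op H0 H0 hVb.
have bT := qbounded_of_bounded_op K0 K0 hTb.
have bX := qbounded_of_bounded_op H0 K0 hX.
have iV h : re_ip ipH (V h) (V h) = re_ip ipH h h.
  by rewrite -!hnorm_sqr // hV.
have cT k : re_ip ipK (T k) (T k) <= re_ip ipK k k by rewrite -ler_hnorm.
have [lV _] := bV; have [lT _] := bT; have [lX _] := bX.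
split=> [sim|[[M RM] [A [E [[bA0 bE] _ ER XE /(quad_nearP hK hH _ lT lV) qA]]]]].
  split; first exact: power_bounded_of_similar.
  move: sim => /(similar_to_contractionP _ S0)[S [Si]]; rewrite re_ip_sum.
  move=> [bS bSi SSi _ c].
  have [W [bW XW]] := splitting_of_similar hBK hBH bT bX lV iV bS bSi SSi c.
  have [A [bA AV qA]] := wandering_bounded_of_splitting hBK hBH bT bV iV bW XW.
  have [lA _] := bA.
  exists A, (fun p => (X p.2 - A p.2, 0)); split; first split.
  - exact: bounded_op_of_qbounded.
  - apply: bounded_op_of_qbounded => //; rewrite re_ip_sum.
    have [lF [N N0 FN]] := qbounded_add fK bX (qbounded_opp fK bA).
    split; first by move=> a p p'; congr pair; rewrite /= ?lF // scaler0 addr0.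
    exists N => // -[k h]; rewrite /prod_form /= (form0l fH) addr0 mulrDr.
    by apply: le_trans (FN h) _; rewrite lerDr mulr_ge0.
  (* [E] reads only the second coordinate and writes only the first, so its square is 0. *)
  - by exists 2 => p /=; rewrite (lin0 lX) (lin0 lA) subrr.
  - by move=> p; rewrite /Rop /= AV subrr.
  - by move=> p; congr pair; rewrite /= ?addr0 // -addrA [A _ + _]addrC subrK.
  - by apply/(quad_nearP hK hH _ lT lV).
have bA := qbounded_of_bounded_op H0 K0 bA0.
have EE p : E p = (X p.2 - A p.2, 0).
  have -> : E p = Rop T V X p - Rop T V A p by rewrite XE [_ + E p]addrC addrK.
  by congr pair; rewrite /= ?subrr // opprD addrACA subrr add0r.
(* The relation [E R(A) = 0] at [(0, h)], where the second coordinate of [R(A) (0, h)] is [V h]. *)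
have AV h : A (V h) = X (V h).
  by have := ER (0, h); rewrite EE => -[/eqP]; rewrite subr_eq0 => /eqP.
have [g [bg Tg]] := hTr.
have bg' := qbounded_of_bounded_op K0 K0 bg.
have XM n h : re_ip ipK (corner T V X n h) (corner T V X n h) <= M ^+ 2 * re_ip ipH h h.
  have := hnorm_le_mul S0 S0 (RM n (0, h)); rewrite re_ip_sum /prod_form /=.
  by rewrite (form0l fK) add0r; apply: le_trans; rewrite lerDl.
have [W [bW XW]] :=
  splitting_of_wandering_bounded hBK hBH bT cT bV iV bX bA AV qA bg' Tg (sqr_ge0 M) XM.
apply/(similar_to_contractionP _ S0); rewrite re_ip_sum.
exact: similar_of_splitting bW cT XW.
Qed.
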